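(* Let $f$ be as in the context, let $\bar\varepsilon=\int_0^1 f^-(s)\,ds$, and for $\varepsilon>\bar\varepsilon$ let $c_\varepsilon^*$ be the speed, defined in the context, of the increasing regular front connecting $0$ and $1$. Then $$\lim_{\varepsilon\to\bar\varepsilon^+}c_\varepsilon^*=0.$$
   Context: Assumptions on $f$: $f:[0,1]\to\mathbb{R}$ is continuous, $f(0)=f(1)=0$, and there is $\alpha\in(0,1)$ with $f(\alpha)=0$ and $f(s)(s-\alpha)>0$ for every $s\in(0,1)\setminus\{\alpha\}$. Moreover $\int_0^1 f(s)\,ds>0$, the derivative $f'(\alpha)$ exists and is $>0$, and $|f(s)|\le f'(\alpha)|s-\alpha|$ for every $s\in[0,1]$. Finally there is $l>0$ such that $f(s)\ge -ls$ and $f(s)\le l(1-s)$ for every $s\in[0,1]$. Notation: $f^-=\max\{-f,0\}$. Definition of $c_\varepsilon^*$: for $\varepsilon>\bar\varepsilon$, $c_\varepsilon^*>0$ is the unique $c\ge 0$ for which the equation $$\varepsilon\left(\frac{v'}{\sqrt{1+(v')^2}}\right)'-c\,v'+f(v)=0\qquad\text{on }\mathbb{R}$$ has an increasing solution $v\in C^2(\mathbb{R})$ with $v(-\infty)=0$ and $v(+\infty)=1$ (existence and uniqueness of such a $c$ are known). *)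

(* Defs.v *)
From Stdlib Require Import Reals.
From Coquelicot Require Import Coquelicot.
Open Scope R_scope.

(* Only the values of [f] on [0,1] are constrained; since [0 < alpha < 1],
   [Derive f alpha] depends on these values alone. *)
Record reaction (f : R -> R) (alpha : R) : Prop := {
  reaction_cont : continuous_on (fun s => 0 <= s <= 1) f;
  reaction_0 : f 0 = 0;
  reaction_1 : f 1 = 0;
  reaction_alpha_01 : 0 < alpha < 1;
  reaction_alpha : f alpha = 0;
  reaction_sign : forall s, 0 < s < 1 -> s <> alpha -> 0 < f s * (s - alpha);
  reaction_int : 0 < RInt f 0 1;
  reaction_ex_derive : ex_derive f alpha;
  reaction_derive_pos : 0 < Derive f alpha;
  reaction_lin : forall s, 0 <= s <= 1 ->
    Rabs (f s) <= Derive f alpha * Rabs (s - alpha);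
  reaction_ends : exists l, 0 < l /\
    forall s, 0 <= s <= 1 -> - l * s <= f s /\ f s <= l * (1 - s)
}.

Definition neg_part (f : R -> R) (s : R) : R := Rmax (- f s) 0.

Definition eps_bar (f : R -> R) : R := RInt (neg_part f) 0 1.

(* [Derive] is total, so differentiability is required at each order. *)
Definition C2 (v : R -> R) : Prop :=
  forall x, ex_derive v x /\ ex_derive (Derive v) x /\
            continuous (Derive (Derive v)) x.

Definition flux (v : R -> R) (x : R) : R :=
  Derive v x / sqrt (1 + (Derive v x) ^ 2).

(* Monotonicity and the two limits force [v] into [0,1], the domain of [f]. *)
Record front (f : R -> R) (eps c : R) (v : R -> R) : Prop := {
  front_C2 : C2 v;
  front_incr : strict_increasing v;
  front_eq : forall x, eps * Derive (flux v) x - c * Derive v x + f (v x) = 0;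
  front_minfty : is_lim v m_infty 0;
  front_pinfty : is_lim v p_infty 1
}.

Definition front_speed (f : R -> R) (eps c : R) : Prop :=
  0 <= c /\ exists v, front f eps c v.

(* The relation "c_eps^* = c": [c] is the only nonnegative speed carrying a front. *)
Definition critical_speed (f : R -> R) (eps c : R) : Prop :=
  unique (front_speed f eps) c.

(* Main.v *)
(** Write [F(s)] for the integral of [f] over [[0,s]].  Along a front [v] the
    energy [G = eps (1 - 1 / sqrt (1 + v'^2)) + F(v)] satisfies
    [G' = c v'^2 >= 0] and vanishes at [-oo], so [G >= 0].  Where [v = alpha] we
    have [F(v) = - eps_bar], hence [G < eps - eps_bar] there.  On the other hand
    [G >= 0] bounds [v'] below by a constant [K > 0] independent of [eps] while
    [alpha/2 <= v <= alpha], so that [G] grows by at least [c K alpha/2] over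
    this range.  Therefore [c <= (eps - eps_bar) / (K alpha/2)]. *)
Require Import Defs.
From Stdlib Require Import Reals Lra.
From Coquelicot Require Import Coquelicot.
Open Scope R_scope.

(* Constant extension outside [[0,1]], making the primitive of [f]
   differentiable on the whole line. *)
Definition clamp_ext (f : R -> R) (s : R) : R := f (Rmax 0 (Rmin s 1)).

Lemma clamp_ext_eq (f : R -> R) (s : R) : 0 <= s <= 1 -> clamp_ext f s = f s.
Proof.
intros [H0 H1]; unfold clamp_ext.
now rewrite Rmin_left, Rmax_right.
Qed.

Lemma clamp_in (s : R) : 0 <= Rmax 0 (Rmin s 1) <= 1.
Proof. unfold Rmax, Rmin; repeat destruct Rle_dec; lra. Qed.

Lemma continuous_clamp_ext (f : R -> R) (x : R) :
  continuous_on (fun s => 0 <= s <= 1) f -> continuous (clamp_ext f) x.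
Proof.
intros Hf; apply filterlim_locally; intros eps.
destruct (proj1 (filterlim_locally _ _) (Hf _ (clamp_in x)) eps) as [d Hd].
exists d; intros y Hy; apply Hd; [| apply clamp_in].
change (Rabs (y - x) < d) in Hy.
(* The truncation to [[0,1]] is 1-Lipschitz, so the same radius [d] serves. *)
change (Rabs (Rmax 0 (Rmin y 1) - Rmax 0 (Rmin x 1)) < d).
revert Hy; unfold Rmax, Rmin, Rabs.
repeat destruct Rle_dec; repeat destruct Rcase_abs; lra.
Qed.

Definition primitive (f : R -> R) (s : R) : R := RInt (clamp_ext f) 0 s.

(** * The primitive of [f] on [[0, alpha]] *)

Section Reaction.
Variables (f : R -> R) (alpha : R).
Hypothesis hf : reaction f alpha.

Let cont x : continuous (clamp_ext f) x :=
  continuous_clamp_ext f x (reaction_cont _ _ hf).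

Let ex_int a b : ex_RInt (clamp_ext f) a b.
Proof. apply (ex_RInt_continuous (V := R_CompleteNormedModule)); intros; apply cont. Qed.

Lemma is_derive_primitive (x : R) :
  is_derive (primitive f) x (clamp_ext f x).
Proof.
apply is_derive_RInt with 0; [| apply cont].
apply filter_forall; intros y; apply (RInt_correct (V := R_CompleteNormedModule)), ex_int.
Qed.

Lemma reaction_neg (s : R) : 0 < s < alpha -> clamp_ext f s < 0.
Proof.
intros Hs; destruct (reaction_alpha_01 _ _ hf).
rewrite clamp_ext_eq by lra.
assert (H1 := reaction_sign _ _ hf s ltac:(lra) ltac:(lra)).
nra.
Qed.

Lemma reaction_nonneg (s : R) : alpha < s < 1 -> 0 <= f s.
Proof.
intros Hs; destruct (reaction_alpha_01 _ _ hf).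
assert (H1 := reaction_sign _ _ hf s ltac:(lra) ltac:(lra)).
nra.
Qed.

Lemma primitive_lt (a b : R) :
  0 <= a -> a < b -> b <= alpha -> primitive f b < primitive f a.
Proof.
intros Ha Hab Hb.
destruct (MVT_cor2 (primitive f) (clamp_ext f) a b Hab) as [c [Hc1 Hc2]].
{ intros; apply is_derive_Reals, is_derive_primitive. }
assert (H := reaction_neg c ltac:(lra)).
nra.
Qed.

(** The sign of [f] makes [neg_part f] equal to [- f] before [alpha] and zero after it. *)
Lemma primitive_alpha : primitive f alpha = - eps_bar f.
Proof.
destruct (reaction_alpha_01 _ _ hf) as [Ha0 Ha1].
unfold primitive, eps_bar; symmetry.
assert (H1 : is_RInt (neg_part f) 0 alpha (- RInt (clamp_ext f) 0 alpha)).
{ apply is_RInt_ext with (fun s => opp (clamp_ext f s)).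
  - intros s; rewrite Rmin_left, Rmax_right by lra; intros Hs.
    assert (H := reaction_neg s Hs).
    unfold neg_part; rewrite <- (clamp_ext_eq f s) by lra.
    rewrite Rmax_left by lra; reflexivity.
  - apply (is_RInt_opp (V := R_NormedModule)), (RInt_correct (V := R_CompleteNormedModule)), ex_int. }
assert (H2 : is_RInt (neg_part f) alpha 1 0).
{ apply is_RInt_ext with (fun _ => 0).
  - intros s; rewrite Rmin_left, Rmax_right by lra; intros Hs.
    assert (H := reaction_nonneg s Hs).
    unfold neg_part; rewrite Rmax_right by lra; reflexivity.
  - evar_last; [apply (is_RInt_const (V := R_NormedModule)) |].
    apply (scal_zero_r (V := R_ModuleSpace)). }
rewrite (is_RInt_unique _ _ _ _ (is_RInt_Chasles _ _ _ _ _ _ H1 H2)).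
unfold plus; simpl; ring.
Qed.

(** The primitive decreases strictly from 0 at 0 to [- eps_bar f] at [alpha]. This gives [eps > 0]
    whenever [eps_bar f < eps]. *)
Lemma eps_bar_pos : 0 < eps_bar f.
Proof.
destruct (reaction_alpha_01 _ _ hf).
assert (H1 := primitive_lt 0 alpha ltac:(lra) ltac:(lra) ltac:(lra)).
rewrite primitive_alpha in H1.
unfold primitive in H1; rewrite RInt_point in H1.
unfold zero in H1; simpl in H1; lra.
Qed.

End Reaction.

(** For [eps > 0], this puts the gradient part of the energy in [[0, eps)]. *)
Lemma inv_sqrt_range (p : R) : 0 < / sqrt (1 + p ^ 2) <= 1.
Proof.
assert (H : 1 <= sqrt (1 + p ^ 2)).
{ rewrite <- sqrt_1 at 1; apply sqrt_le_1_alt; nra. }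
split; [apply Rinv_0_lt_compat; lra |].
apply Rle_trans with (/ 1); [apply Rinv_le_contravar; lra | lra].
Qed.

(** With [L(p) = sqrt (1 + p^2) - 1], whose derivative gives the flux, the gradient part is
    [eps (p L'(p) - L(p))]. *)
Definition energy (f : R -> R) (eps : R) (v : R -> R) (x : R) : R :=
  eps * (1 - / sqrt (1 + Derive v x ^ 2)) + primitive f (v x).

(** * Energy estimates along a front *)

Section Front.
Variables (f : R -> R) (alpha eps c : R) (v : R -> R).
Hypothesis hf : reaction f alpha.
Hypothesis hv : front f eps c v.
Hypothesis heps : eps_bar f < eps.
Hypothesis hc : 0 <= c.

Lemma front_lim_minfty (d : R) (x : R) :
  0 < d -> exists y, y < x /\ Rabs (v y) < d.
Proof.
intros Hd.
destruct (proj2 (is_lim_spec _ _ _) (front_minfty _ _ _ _ hv) (mkposreal d Hd))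
  as [M HM].
exists (Rmin x M - 1); split; [generalize (Rmin_l x M); lra |].
replace (v (Rmin x M - 1)) with (v (Rmin x M - 1) - 0) by ring.
apply HM; generalize (Rmin_r x M); lra.
Qed.

Lemma front_lim_pinfty (d : R) (x : R) :
  0 < d -> exists y, x < y /\ Rabs (v y - 1) < d.
Proof.
intros Hd.
destruct (proj2 (is_lim_spec _ _ _) (front_pinfty _ _ _ _ hv) (mkposreal d Hd))
  as [M HM].
exists (Rmax x M + 1); split; [generalize (Rmax_l x M); lra |].
apply HM; generalize (Rmax_r x M); lra.
Qed.

(** By strict monotonicity, a value at most 0 forces a negative value one unit to the left, which
    keeps [v] away from 0 near [-oo]; symmetrically at 1. *)
Lemma front_range (x : R) : 0 < v x < 1.
Proof.
assert (Hi := front_incr _ _ _ _ hv).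
split; apply Rnot_le_lt; intros Hx.
- assert (H1 := Hi (x - 1) x ltac:(lra)).
  destruct (front_lim_minfty (- v (x - 1)) (x - 1)) as [y [Hy Hvy]]; [lra |].
  assert (H2 := Hi _ _ Hy).
  apply Rabs_def2 in Hvy; lra.
- assert (H1 := Hi x (x + 1) ltac:(lra)).
  destruct (front_lim_pinfty (v (x + 1) - 1) (x + 1)) as [y [Hy Hvy]]; [lra |].
  assert (H2 := Hi _ _ Hy).
  apply Rabs_def2 in Hvy; lra.
Qed.

Lemma front_derive (x : R) : is_derive v x (Derive v x).
Proof. apply Derive_correct, (front_C2 _ _ _ _ hv). Qed.

Lemma front_continuity : continuity v.
Proof.
intros x; apply derivable_continuous_pt.
exists (Derive v x); apply is_derive_Reals, front_derive.
Qed.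

Lemma front_derive_nonneg (x : R) : 0 <= Derive v x.
Proof.
assert (pr : derivable v).
{ intros y; exists (Derive v y); apply is_derive_Reals, front_derive. }
rewrite <- (Derive_Reals v x (pr x)).
apply (nonneg_derivative_0 v pr).
intros y z [Hyz | ->]; [| lra].
left; now apply (front_incr _ _ _ _ hv).
Qed.

Lemma front_onto (s : R) : 0 < s < 1 -> exists x, v x = s.
Proof.
intros Hs.
destruct (front_lim_minfty s 0) as [y [Hy Hvy]]; [lra |].
destruct (front_lim_pinfty (1 - s) 0) as [z [Hz Hvz]]; [lra |].
apply Rabs_def2 in Hvy; apply Rabs_def2 in Hvz.
destruct (IVT (fun x => v x - s) y z) as [x [_ Hx]]; try lra.
- apply continuity_minus; [apply front_continuity |].
  apply continuity_const; intros ? ?; reflexivity.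
- exists x; lra.
Qed.

(** Since [flux' = v'' / (1 + v'^2)^(3/2)], the gradient part has derivative [eps v' flux']. Adding
    [f(v) v'] gives [v'] times [eps flux' + f(v)], which the equation turns into [c v']. *)
Lemma is_derive_energy (x : R) :
  is_derive (energy f eps v) x (c * Derive v x ^ 2).
Proof.
destruct (front_C2 _ _ _ _ hv x) as [H1 [H2 _]].
assert (Hpos : 0 < 1 + Derive v x ^ 2) by nra.
assert (Hs := sqrt_lt_R0 _ Hpos).
assert (Hss := sqrt_sqrt _ (Rlt_le _ _ Hpos)).
assert (Hfl : is_derive (flux v) x
  (Derive (Derive v) x / (sqrt (1 + Derive v x ^ 2)) ^ 3)).
{ unfold flux; auto_derive.
  - repeat split; trivial; simpl in *; lra.
  - simpl in *; rewrite ?Rmult_1_r in *.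
    set (p := Derive v x) in *; set (r := sqrt _) in *.
    change (Derive (fun x0 => Derive v x0) x) with (Derive (Derive v) x).
    field_simplify_eq; [| lra].
    replace (r ^ 2) with (1 + p * p) by (rewrite <- Hss; ring).
    ring. }
assert (He := front_eq _ _ _ _ hv x).
rewrite (is_derive_unique _ _ _ Hfl) in He.
rewrite <- (clamp_ext_eq f (v x)) in He by (generalize (front_range x); lra).
unfold energy; evar_last.
- eapply (is_derive_plus (V := R_NormedModule)); [| eapply (is_derive_comp (V := R_NormedModule));
    [apply is_derive_primitive with alpha; exact hf | apply front_derive]].
  auto_derive; [repeat split; trivial; simpl in *; lra | reflexivity].
- change (Derive (fun x0 => Derive v x0) x) with (Derive (Derive v) x).
  unfold plus, scal; simpl; unfold mult; simpl.
  simpl in *; rewrite ?Rmult_1_r in *.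
  replace (clamp_ext f (v x)) with
    (c * Derive v x - eps * (Derive (Derive v) x /
       (sqrt (1 + Derive v x * Derive v x) *
       (sqrt (1 + Derive v x * Derive v x) *
        sqrt (1 + Derive v x * Derive v x))))) by lra.
  field; lra.
Qed.

Lemma energy_increasing (x y : R) :
  x < y -> energy f eps v x <= energy f eps v y.
Proof.
intros Hxy.
destruct (MVT_cor2 (energy f eps v) (fun x => c * Derive v x ^ 2) x y Hxy)
  as [z [Hz _]].
{ intros; apply is_derive_Reals, is_derive_energy. }
assert (0 <= c * Derive v z ^ 2) by (apply Rmult_le_pos; nra).
nra.
Qed.

(** A negative value at [x] would bound the energy from above on the left of [x]. There
    [primitive f (v y)] comes arbitrarily close to 0 while the gradient part stays nonnegative,
    whatever [v'] does. *)
Lemma energy_nonneg (x : R) : 0 <= energy f eps v x.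
Proof.
apply Rnot_lt_le; intros Hx.
assert (Hc : continuous (primitive f) 0).
{ apply (ex_derive_continuous (V := R_NormedModule)); eexists; apply is_derive_primitive with alpha.
  exact hf. }
destruct (proj1 (filterlim_locally _ _) Hc
  (mkposreal (- energy f eps v x) ltac:(lra))) as [d Hd].
destruct (front_lim_minfty d x (cond_pos d)) as [y [Hy Hvy]].
assert (H1 : Rabs (primitive f (v y) - primitive f 0) < - energy f eps v x).
{ apply Hd; change (Rabs (v y - 0) < d); now rewrite Rminus_0_r. }
unfold primitive at 2 in H1; rewrite RInt_point in H1.
unfold zero in H1; simpl in H1; rewrite Rminus_0_r in H1.
apply Rabs_def2 in H1.
assert (H2 := energy_increasing _ _ Hy).
unfold energy at 1 in H2.
assert (H3 := inv_sqrt_range (Derive v y)).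
assert (H4 := eps_bar_pos _ _ hf).
assert (0 <= eps * (1 - / sqrt (1 + Derive v y ^ 2)))
  by (apply Rmult_le_pos; lra).
lra.
Qed.

(** Nonnegativity of the energy is combined with [1 - 1 / sqrt (1 + p^2) <= p^2 / 2]. *)
Lemma derive_lower_bound (x : R) :
  2 * (- primitive f (v x)) <= eps * Derive v x ^ 2.
Proof.
assert (H0 := energy_nonneg x); unfold energy in H0.
assert (H1 := eps_bar_pos _ _ hf).
assert (Hpos : 0 < 1 + Derive v x ^ 2) by nra.
assert (H : 1 - / sqrt (1 + Derive v x ^ 2) <= Derive v x ^ 2 / 2).
{ assert (Hs := sqrt_lt_R0 _ Hpos).
  assert (Hss := sqrt_sqrt _ (Rlt_le _ _ Hpos)).
  set (r := sqrt _) in *.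
  apply Rmult_le_reg_r with r; [lra |].
  replace ((1 - / r) * r) with (r - 1) by (field; lra).
  replace (Derive v x ^ 2) with (r * r - 1) by lra.
  (* Multiplied by [2 r], the inequality becomes [r^3 - 3 r + 2 >= 0], whose left side is this
     product. *)
  assert (0 <= (r - 1) ^ 2 * (r + 2))
    by (apply Rmult_le_pos; [apply pow2_ge_0 | lra]).
  lra. }
apply Rmult_le_compat_l with (r := eps) in H; lra.
Qed.

Lemma front_speed_bound (K : R) :
  0 <= K -> eps * K ^ 2 <= 2 * (- primitive f (alpha / 2)) ->
  c * K * (alpha / 2) <= eps - eps_bar f.
Proof.
intros HK HKe.
destruct (reaction_alpha_01 _ _ hf) as [Ha0 Ha1].
assert (Heb := eps_bar_pos _ _ hf).
destruct (front_onto (alpha / 2)) as [x1 Hx1]; [lra |].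
destruct (front_onto alpha) as [x0 Hx0]; [lra |].
assert (Hi := front_incr _ _ _ _ hv).
assert (Hmono : forall y z, y <= z -> v y <= v z).
{ intros y z [Hyz | ->]; [left; now apply Hi | lra]. }
assert (Hx : x1 < x0).
{ apply Rnot_le_lt; intros Hle; apply Hmono in Hle; lra. }
(* Subtracting [c K v] compares the growth of the energy with that of [v]: the derivative is
   [c v' (v' - K)], nonnegative once [v' >= K]. *)
destruct (MVT_cor2 (fun x => energy f eps v x - c * K * v x)
  (fun x => c * Derive v x ^ 2 - c * K * Derive v x) x1 x0 Hx)
  as [z [Hz Hzx]].
{ intros y _; apply is_derive_Reals.
  apply (is_derive_minus (V := R_NormedModule)); [apply is_derive_energy |].
  apply is_derive_scal, front_derive. }
(* As [v z] lies between [alpha / 2] and [alpha], where the primitive decreases, [eps v'^2] exceeds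
   [eps K^2] at [z]. *)
assert (HKz : K <= Derive v z).
{ assert (H1 := derive_lower_bound z).
  assert (H2 : primitive f (v z) < primitive f (alpha / 2)).
  { apply primitive_lt with alpha; trivial; try lra.
    - rewrite <- Hx1; now apply Hi.
    - rewrite <- Hx0; left; now apply Hi. }
  assert (H3 := front_derive_nonneg z).
  apply Rnot_lt_le; intros H4.
  assert (Derive v z ^ 2 <= K ^ 2) by nra.
  nra. }
assert (H1 := energy_nonneg x1).
assert (H2 : energy f eps v x0 <= eps - eps_bar f).
{ unfold energy; rewrite Hx0, (primitive_alpha _ _ hf).
  assert (H := inv_sqrt_range (Derive v x0)); nra. }
assert (H3 : 0 <= (c * Derive v z ^ 2 - c * K * Derive v z) * (x0 - x1)).
{ replace (c * Derive v z ^ 2 - c * K * Derive v z)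
    with (c * (Derive v z * (Derive v z - K))) by ring.
  repeat apply Rmult_le_pos; lra. }
rewrite Hx0, Hx1 in Hz; lra.
Qed.

End Front.

Theorem theorem2p9 (f : R -> R) (alpha : R) (cstar : R -> R)
  (hf : reaction f alpha)
  (hc : forall eps, eps_bar f < eps -> critical_speed f eps (cstar eps)) :
  filterlim cstar (at_right (eps_bar f)) (locally 0).
Proof.
destruct (reaction_alpha_01 _ _ hf) as [Ha0 Ha1].
assert (Heb := eps_bar_pos _ _ hf).
assert (Hm := primitive_lt _ _ hf 0 (alpha / 2) ltac:(lra) ltac:(lra) ltac:(lra)).
unfold primitive at 2 in Hm; rewrite RInt_point in Hm.
unfold zero in Hm; simpl in Hm.
(* [K = sqrt q] meets the condition of [front_speed_bound] with equality at [eps = eps_bar f + 1],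
   hence works for every smaller [eps]. *)
set (q := 2 * (- primitive f (alpha / 2)) / (eps_bar f + 1)).
assert (Hq : 0 < q) by (apply Rdiv_lt_0_compat; lra).
set (K := sqrt q).
assert (HK : 0 < K) by now apply sqrt_lt_R0.
assert (HK2 : (eps_bar f + 1) * K ^ 2 = 2 * (- primitive f (alpha / 2))).
{ unfold K; rewrite pow2_sqrt by lra; unfold q; field; lra. }
assert (HKa : 0 < K * (alpha / 2)) by (apply Rmult_lt_0_compat; lra).
apply filterlim_locally; intros d.
(* The bound 1 keeps [eps] below [eps_bar f + 1], so that [K] is admissible; the other makes the
   speed estimate smaller than [d]. *)
assert (Hr : 0 < Rmin 1 (d * (K * (alpha / 2)))).
{ apply Rmin_glb_lt; [lra |].
  apply Rmult_lt_0_compat; [apply cond_pos | exact HKa]. }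
exists (mkposreal _ Hr); intros eps Heps Hlt.
change (Rabs (eps - eps_bar f) < Rmin 1 (d * (K * (alpha / 2)))) in Heps.
change (Rabs (cstar eps - 0) < d).
apply Rabs_def2 in Heps.
assert (H1 := Rmin_l 1 (d * (K * (alpha / 2)))).
assert (H2 := Rmin_r 1 (d * (K * (alpha / 2)))).
destruct (hc eps Hlt) as [[Hc [v Hv]] _].
assert (H3 := front_speed_bound f alpha eps (cstar eps) v hf Hv Hlt Hc K
  (Rlt_le _ _ HK)).
rewrite Rminus_0_r, Rabs_right by lra.
apply Rmult_lt_reg_r with (K * (alpha / 2)); [exact HKa |].
assert (eps * K ^ 2 <= (eps_bar f + 1) * K ^ 2)
  by (apply Rmult_le_compat_r; nra).
lra.
Qed.
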